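(* Fix $\epsilon>0$. Consider the random profile matching problem RPMP-$k$ (defined in the context) with $n$ men, $n$ women, $k=k(n)$, under the Weighted Hamming distance $d_w(\mathbf{a},\mathbf{a}')=\sum_{i=1}^k 2^{-i}\mathbf{1}(a_i\neq a_i')$. Then, with high probability: (i) if $k(n)>(1+\epsilon)\log n$, the fraction of participants with multiple stable partners tends to zero as $n\to\infty$; moreover $\frac{\log X}{\log n}\to -1$ in probability as $n\to\infty$, where $X$ is the matching distance of a randomly chosen participant; and (ii) if $k(n)>(2+\epsilon)\log n$, the stable matching is unique without resorting to tie-breaking (i.e., there is exactly one stable matching, and it does not depend on the tie-breaking lists).
   Context: RPMP-$k$: there is a set $\mathcal{M}$ of $n$ men and a set $\mathcal{W}$ of $n$ women. Each participant $x$ has a profile $\mathbf{a}(x)\in Q_k=\{0,1\}^k$; the profiles are independent and uniformly distributed on $Q_k$. Write $d_w(x,y)=d_w(\mathbf{a}(x),\mathbf{a}(y))$. Each participant $x$ has a tie-breaking list $T_x$, a uniformly random ordering of the opposite sex, all independent of each other and of the profiles. The strict preference list of $x$ ranks the opposite sex in increasing order of $d_w(x,\cdot)$, breaking ties by $T_x$. Stable matchings are in the sense of Gale and Shapley; $y$ is a stable partner of $x$ if they are matched in some stable matching. The matching distance of $x$ is $d_w(x,\mu(x))$ for a stable matching $\mu$ (this value is the same for all stable matchings). ''With high probability'' means with probability tending to $1$ as $n\to\infty$. $\log$ denotes the base-$2$ logarithm. *)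

(* Defs.v *)
From HB Require Import structures.
From mathcomp Require Import all_boot all_order all_algebra all_fingroup.
From mathcomp Require Import all_classical all_reals all_analysis.
Set Implicit Arguments. Unset Strict Implicit. Unset Printing Implicit Defensive.
Import Order.TTheory GRing.Theory Num.Theory.
Local Open Scope ring_scope.

Definition Pr (R : realType) (T : finType) (E : pred T) : R :=
  (#|E|%:R) / (#|T|%:R).

Definition log2 (R : realType) (x : R) : R := ln x / ln 2.

Definition profiles (n k : nat) : finType := {ffun 'I_n -> {ffun 'I_k -> bool}}.
(* Tie-breaking lists of the n men (resp. women): for participant x, the
   permutation T_x gives the rank T_x y of y (smaller = preferred). *)
Definition ties (n : nat) : finType := {ffun 'I_n -> {perm 'I_n}}.

(* Sample space of RPMP-k: men's profiles, women's profiles,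
   men's tie-breaking lists, women's tie-breaking lists (uniform product). *)
Definition Omega (n k : nat) : finType :=
  (profiles n k * profiles n k * (ties n * ties n))%type.

(* Weighted Hamming distance  d_w(a,a') = sum_{i=1}^k 2^{-i} 1(a_i <> a'_i)
   (index i : 'I_k stands for coordinate i+1). *)
Definition dw (R : realType) (k : nat) (a b : {ffun 'I_k -> bool}) : R :=
  \sum_(i < k | a i != b i) (2 : R) ^- i.+1.

Section RPMP.
Variables (R : realType) (n k : nat).
Implicit Types (pm pw : profiles n k) (tm tw : ties n) (mu : {perm 'I_n}).

Definition lexpref (dx dy : R) (rx ry : nat) : bool :=
  (dx < dy) || ((dx == dy) && (rx < ry)%N).

Definition man_prefers pm pw tm (m w1 w2 : 'I_n) : bool :=
  lexpref (dw R (pm m) (pw w1)) (dw R (pm m) (pw w2)) (tm m w1) (tm m w2).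

Definition woman_prefers pm pw tw (w m1 m2 : 'I_n) : bool :=
  lexpref (dw R (pw w) (pm m1)) (dw R (pw w) (pm m2)) (tw w m1) (tw w m2).

Definition stable pm pw tm tw mu : bool :=
  [forall m : 'I_n, forall w : 'I_n,
     ~~ (man_prefers pm pw tm m w (mu m) &&
         woman_prefers pm pw tw w m ((mu^-1)%g w))].

Definition man_multiple pm pw tm tw (m : 'I_n) : bool :=
  [exists mu1 : {perm 'I_n}, exists mu2 : {perm 'I_n},
     [&& stable pm pw tm tw mu1, stable pm pw tm tw mu2 & mu1 m != mu2 m]].

Definition woman_multiple pm pw tm tw (w : 'I_n) : bool :=
  [exists mu1 : {perm 'I_n}, exists mu2 : {perm 'I_n},
     [&& stable pm pw tm tw mu1, stable pm pw tm tw mu2 &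
         (mu1^-1)%g w != (mu2^-1)%g w]].

Definition frac_multiple (o : Omega n k) : R :=
  let: (pm, pw, (tm, tw)) := o in
  (#|[pred m | man_multiple pm pw tm tw m]| +
   #|[pred w | woman_multiple pm pw tm tw w]|)%:R / (2 * n)%:R.

Definition match_dist pm pw mu (p : 'I_n + 'I_n) : R :=
  match p with
  | inl m => dw R (pm m) (pw (mu m))
  | inr w => dw R (pw w) (pm ((mu^-1)%g w))
  end.

(* X deviates: log X / log n is not within delta of -1
   (X = 0 means log X = -oo, which counts as a deviation). *)
Definition deviates (delta x : R) : bool :=
  (x == 0) || (delta < `| log2 x / log2 (n%:R) + 1 |).

(* Event on (outcome, uniformly chosen participant): the participant's
   matching distance (in a stable matching) deviates. *)
Definition X_deviates (delta : R) (op : Omega n k * ('I_n + 'I_n)) : bool :=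
  let: ((pm, pw, (tm, tw)), p) := op in
  [exists mu : {perm 'I_n}, stable pm pw tm tw mu && deviates delta (match_dist pm pw mu p)].

Definition unique_without_ties (o : Omega n k) : bool :=
  let: (pm, pw, _) := o in
  [exists mu : {perm 'I_n}, forall tm : ties n, forall tw : ties n,
     forall mu' : {perm 'I_n}, stable pm pw tm tw mu' == (mu' == mu)].

End RPMP.

(* Main.v *)
(* With the weighted Hamming distance, a participant prefers partners sharing a
   longer profile prefix, and ties occur only between identical profiles.

   All stable matchings give a participant the same matching distance: at the
   smallest distance where two of them disagree, ties would propagate along a
   cycle of the two matchings. Hence a second stable partner must have the same
   profile as the first one, which bounds the number of participants with
   several stable partners by the number of profile collisions, on average
   O(n^2 2^-k). If all profiles within each sex are distinct, the stable
   matching exists and is unique whatever the tie-breaking lists.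

   For the matching distance X: X < 2^-j requires a collision of j-bit prefixes,
   which has probability O(n 2^-j). Conversely, in each block of participants
   sharing their first j bits, the unmatched ones have a single sex, so that
   they are at most |x_v|, where x_v is the number of men minus the number of
   women in block v; the sum of the x_v^2 has mean at most 2n, so the proportion
   of participants with X >= 2^-j is O(sqrt (2^j / n)). *)
Require Import Defs.
From HB Require Import structures.
From mathcomp Require Import all_boot all_order all_algebra all_fingroup.
From mathcomp Require Import all_classical all_reals all_analysis.
From mathcomp Require Import zify ring lra.
Import Order.TTheory GRing.Theory Num.Theory numFieldNormedType.Exports.
Local Open Scope classical_set_scope.
Local Open Scope ring_scope.
Set Implicit Arguments. Unset Strict Implicit. Unset Printing Implicit Defensive.

(** * Binary expansions and the prefix structure of the distance *)

Section Distance.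
Variable R : realType.

(** Digits are indexed by all of [nat] so that inductions on [k] can peel off the leading digit by
    precomposing with [succn]. *)
Definition dyadic k (f : nat -> bool) : R := \sum_(i < k | f i) 2 ^- i.+1.

Lemma dyadicS k f : dyadic k.+1 f = ((f 0)%:R + dyadic k (f \o succn)) / 2.
Proof.
rewrite /dyadic big_mkcond big_ord_recl mulrDl; congr (_ + _).
  by case: (f 0); rewrite ?mul1r ?mul0r.
rewrite mulr_suml [RHS]big_mkcond /=; apply: eq_bigr => i _.
rewrite [bump 0 i]add1n; case: ifP => // _.
by rewrite -invfM -exprSr.
Qed.

Lemma dyadic_ge0 k f : 0 <= dyadic k f.
Proof. by apply: sumr_ge0 => i _; rewrite invr_ge0 exprn_ge0. Qed.

Lemma dyadic_lt1 k f : dyadic k f < 1.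
Proof.
elim: k f => [|k IH] f; first by rewrite /dyadic big_ord0.
by rewrite dyadicS; have := IH (f \o succn); case: (f 0) => /=; lra.
Qed.

(** Tails are nonnegative and strictly below 1, so the value is at least 1/2 exactly when the
    leading digit is 1. *)
Lemma dyadic_inj k f g : dyadic k f = dyadic k g -> forall i, (i < k)%N -> f i = g i.
Proof.
elim: k f g => [//|k IH] f g; rewrite !dyadicS => H.
have F1 := dyadic_lt1 k (f \o succn); have F0 := dyadic_ge0 k (f \o succn).
have G1 := dyadic_lt1 k (g \o succn); have G0 := dyadic_ge0 k (g \o succn).
have fg0 : f 0 = g 0.
  by move: H; case: (f 0); case: (g 0) => //= H; exfalso; lra.
have H' : dyadic k (f \o succn) = dyadic k (g \o succn).
  by move: H; rewrite fg0; lra.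
by case=> // i ik; apply: (IH _ _ H').
Qed.

Lemma dyadic_lt_prefix j k f : (j <= k)%N -> (forall i, (i < j)%N -> ~~ f i) ->
  dyadic k f < 2 ^- j.
Proof.
elim: j k f => [|j IH] k f; first by rewrite expr0 invr1 => _ _; apply: dyadic_lt1.
case: k => // k jk Hf; rewrite dyadicS (negbTE (Hf 0 isT)) add0r.
rewrite exprSr invfM ltr_pM2r ?invr_gt0 //.
by apply: IH => // i ij; apply: Hf.
Qed.

Lemma dyadic_ge_prefix i k (f : nat -> bool) : (i < k)%N -> f i -> 2 ^- i.+1 <= dyadic k f.
Proof.
move=> ik fi; rewrite /dyadic (bigD1 (Ordinal ik)) //= lerDl.
by apply: sumr_ge0 => *; rewrite invr_ge0 exprn_ge0.
Qed.

Variable k : nat.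
Implicit Types a b c : {ffun 'I_k -> bool}.

Definition xorn a b (i : nat) : bool :=
  if insub i is Some j then a j != b j else false.

Lemma xornE a b (i : 'I_k) : xorn a b i = (a i != b i).
Proof. by rewrite /xorn valK. Qed.

Lemma dwE a b : dw R a b = dyadic k (xorn a b).
Proof. by apply: eq_bigl => i; rewrite xornE. Qed.

Lemma dwC a b : dw R a b = dw R b a.
Proof. by apply: eq_bigl => i; rewrite eq_sym. Qed.

Lemma dw_inj a : injective (dw R a).
Proof.
move=> b c; rewrite !dwE => /dyadic_inj H; apply/ffunP => i.
have := H i (ltn_ord i); rewrite !xornE.
by case: (a i); case: (b i); case: (c i).
Qed.

Variables (j : nat) (jk : (j <= k)%N).

Definition bit_prefix a : {ffun 'I_j -> bool} := [ffun i => a (widen_ord jk i)].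

Lemma bit_prefixP a b :
  reflect (forall i : 'I_k, (i < j)%N -> a i = b i) (bit_prefix a == bit_prefix b).
Proof.
apply: (iffP eqP) => [/ffunP H i ij|H].
  have := H (Ordinal ij); rewrite !ffunE.
  by rewrite (_ : widen_ord _ _ = i) //; apply: val_inj.
by apply/ffunP => i; rewrite !ffunE; apply: H => /=.
Qed.

(** A difference at an index [i < j] already contributes [2 ^- i.+1], at least [2 ^- j], while
    differences from [j] on add up to less than [2 ^- j]. *)
Lemma dw_prefix a b : (dw R a b < 2 ^- j) = (bit_prefix a == bit_prefix b).
Proof.
rewrite dwE; apply/idP/idP => [H|/bit_prefixP H].
  apply: contraLR H => /bit_prefixP H; rewrite -leNgt.
  have [i ij abi] : exists2 i : 'I_k, (i < j)%N & a i != b i.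
    apply: contrapT => H'; apply: H => i ij.
    by apply: contrapT => /eqP abi; apply: H'; exists i.
  apply: le_trans (dyadic_ge_prefix (ltn_ord i) _); last by rewrite xornE.
  rewrite lef_pV2 ?posrE ?exprn_gt0 // ler_eXn2l //.
  by rewrite ltr1n.
apply: dyadic_lt_prefix => // i ij.
have ik : (i < k)%N := leq_trans ij jk.
by rewrite (xornE a b (Ordinal ik)) (H (Ordinal ik)) // eqxx.
Qed.

Lemma card_prefix a : (#|[pred b | bit_prefix a == bit_prefix b]| * 2 ^ j = 2 ^ k)%N.
Proof.
have -> : #|[pred b | bit_prefix a == bit_prefix b]| =
  (\prod_(i < k) if (i < j)%N then 1 else 2)%N.
  rewrite (eq_card (B := family (fun i : 'I_k => if (i < j)%N then pred1 (a i) else predT))).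
    rewrite card_family foldrE big_image /=.
    by apply: eq_bigr => i _; case: ifP; rewrite ?card1 ?card_bool.
  move=> b; rewrite !inE; apply/bit_prefixP/familyP => H i.
    by case: ifP => // /H ->; rewrite !inE.
  by move=> ij; have := H i; rewrite ij inE => /eqP.
have -> : (2 ^ j = \prod_(i < k) if (i < j)%N then 2 else 1)%N.
  rewrite -big_mkcond (big_ord_narrow (F := fun=> 2%N) jk) /=.
  by rewrite prod_nat_const card_ord.
rewrite -big_split /= -[in RHS](card_ord k) -prod_nat_const.
by apply: eq_bigr => i _; case: ifP.
Qed.

End Distance.

(** * Stable matchings: equality of distances, existence, uniqueness *)

Section Matching.
Variables (R : realType) (n k : nat).
Implicit Types (pm pw : profiles n k) (tm tw : ties n) (mu : {perm 'I_n}).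

Local Notation mdist := (match_dist R).

Lemma lexpref_asym (x y : R) r s : r != s -> ~~ lexpref x y r s -> lexpref y x s r.
Proof.
rewrite /lexpref negb_or negb_and -leNgt -leqNgt => rs /andP[].
rewrite le_eqVlt eq_sym => /orP[/eqP <-|->//].
by rewrite eqxx /= => sr; rewrite ltn_neqAle eq_sym rs sr orbT.
Qed.

Lemma lexpref_irr (x : R) r : lexpref x x r r = false.
Proof. by rewrite /lexpref ltxx ltnn andbF. Qed.

Lemma lexpref_le (x y : R) r s : lexpref x y r s -> x <= y.
Proof. by case/orP => [/ltW//|/andP[/eqP ->]]. Qed.

Lemma man_prefers_asym pm pw tm m w1 w2 : w1 != w2 ->
  ~~ man_prefers R pm pw tm m w1 w2 -> man_prefers R pm pw tm m w2 w1.
Proof.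
move=> w12; apply: lexpref_asym.
by rewrite (inj_eq val_inj) (inj_eq perm_inj).
Qed.

Lemma man_prefers_le pm pw tm m w1 w2 : man_prefers R pm pw tm m w1 w2 ->
  dw R (pm m) (pw w1) <= dw R (pm m) (pw w2).
Proof. exact: lexpref_le. Qed.

Lemma stableP pm pw tm tw mu :
  reflect (forall m w, man_prefers R pm pw tm m w (mu m) ->
             ~~ man_prefers R pw pm tw w m ((mu^-1)%g w))
          (stable R pm pw tm tw mu).
Proof.
apply: (iffP forallP) => [H m w Hm|H m].
  by have /forallP/(_ w) := H m; rewrite Hm.
apply/forallP => w; rewrite negb_and -implybE; apply/implyP; exact: H.
Qed.

(** Stability treats both sexes alike; this transfers statements proved for men to women. *)
Lemma stable_dual pm pw tm tw mu :
  stable R pm pw tm tw mu -> stable R pw pm tw tm (mu^-1)%g.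
Proof.
move=> /stableP H; apply/stableP => w m; rewrite invgK => Hw.
by apply/negP => Hm; move: (H m w Hm); rewrite Hw.
Qed.

Definition swap (p : 'I_n + 'I_n) : 'I_n + 'I_n :=
  match p with inl x => inr x | inr x => inl x end.

Lemma swapK : involutive swap. Proof. by case. Qed.

Lemma match_dist_dual pm pw mu p :
  mdist pw pm (mu^-1)%g (swap p) = mdist pm pw mu p.
Proof. by case: p => x //=; rewrite invgK. Qed.

Lemma match_dist_partner pm pw mu m :
  mdist pm pw mu (inr (mu m)) = mdist pm pw mu (inl m).
Proof. by rewrite /= permK dwC. Qed.

Lemma match_dist_partnerV pm pw mu w :
  mdist pm pw mu (inl ((mu^-1)%g w)) = mdist pm pw mu (inr w).
Proof. by rewrite /= permKV dwC. Qed.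

(* The men preferring mu1 to mu2 form, from m on, an orbit of mu1 * mu2^-1
   along which both distances stay equal to D; the orbit returns to m. *)
Lemma match_dist_eq_minimal pm pw tm tw mu1 mu2 (D : R) m :
  stable R pm pw tm tw mu1 -> stable R pm pw tm tw mu2 ->
  (forall q, mdist pm pw mu1 q != mdist pm pw mu2 q ->
     D <= mdist pm pw mu1 q /\ D <= mdist pm pw mu2 q) ->
  mdist pm pw mu1 (inl m) = D -> mdist pm pw mu2 (inl m) = D.
Proof.
move=> st1 st2 Dmin D1m; apply/eqP/negPn/negP => D2m.
have [] := Dmin (inl m); first by rewrite D1m eq_sym.
move=> _; rewrite le_eqVlt eq_sym (negbTE D2m) /= => ltD.
pose s := (mu1 * mu2^-1)%g.
pose Q x := mdist pm pw mu1 (inl x) = D /\ man_prefers R pm pw tm x (mu1 x) (mu2 x).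
have step x : Q x -> Q (s x) /\ mdist pm pw mu2 (inl (s x)) = D.
  case=> D1x prefx; set w := mu1 x in prefx; set y := s x.
  have mu2y : mu2 y = w by rewrite /y /s permM permKV.
  have yE : y = (mu2^-1)%g w by rewrite /y permM.
  have xy : x != y.
    apply: contraTneq prefx => exy.
    have -> : mu2 x = w by rewrite exy.
    by rewrite /man_prefers lexpref_irr.
  (* Since [x] prefers [w] to his [mu2] partner, stability of [mu2] makes [w] prefer her own [mu2]
     partner [y] to [x]. *)
  have wpref : man_prefers R pw pm tw w y x.
    by apply: man_prefers_asym => //; rewrite yE; exact: (stableP _ _ _ _ _ st2).
  have D1w : mdist pm pw mu1 (inr w) = D by rewrite match_dist_partner.
  have D2w : mdist pm pw mu2 (inr w) = D.
    have le2 : mdist pm pw mu2 (inr w) <= D.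
      rewrite -D1w /= /w permK -/w -yE; exact: man_prefers_le wpref.
    apply/eqP/negPn/negP => ne; have [] := Dmin (inr w).
      by rewrite D1w eq_sym.
    by move=> _ le2'; move: ne; rewrite eq_le le2 le2'.
  have D2y : mdist pm pw mu2 (inl y) = D by rewrite yE match_dist_partnerV.
  (* Now [w] prefers [y] to her [mu1] partner [x], so stability of [mu1] makes [y] prefer [mu1 y] to
     [w]. *)
  have ypref : man_prefers R pm pw tm y (mu1 y) w.
    apply: man_prefers_asym; first by rewrite /w (inj_eq perm_inj).
    apply/negP => /(stableP _ _ _ _ _ st1).
    by rewrite /w permK -/w wpref.
  split=> //; split; last by rewrite mu2y.
  have le1 : mdist pm pw mu1 (inl y) <= D.
    by rewrite -D2y /= mu2y; exact: man_prefers_le ypref.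
  apply/eqP/negPn/negP => ne; have [] := Dmin (inl y); first by rewrite D2y.
  by move=> le1'; move: ne; rewrite eq_le le1 le1'.
have Qm : Q m by split=> //; rewrite /man_prefers /lexpref; move: D1m ltD => /= -> ->.
have iterQ i : Q ((s ^+ i)%g m).
  by elim: i => [|i IH]; rewrite ?expg0 ?perm1 // expgSr permM; case: (step _ IH).
(* Applied to the predecessor of [m] on its cycle, [step] gives [m] itself the distance [D] under
   [mu2]. *)
have [] := step _ (iterQ #[s]%g.-1).
rewrite -permM -expgSr prednK ?order_gt0 // expg_order perm1 => _ D2m'.
by rewrite D2m' eqxx in D2m.
Qed.

Lemma match_dist_unique pm pw tm tw mu1 mu2 p :
  stable R pm pw tm tw mu1 -> stable R pm pw tm tw mu2 ->
  mdist pm pw mu1 p = mdist pm pw mu2 p.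
Proof.
move=> st1 st2; apply/eqP/negPn/negP => Hp.
pose P q := mdist pm pw mu1 q != mdist pm pw mu2 q.
pose F q := Num.min (mdist pm pw mu1 q) (mdist pm pw mu2 q).
(* [q] is a disagreeing participant whose smaller distance [F q] is least, so [F q] bounds both
   distances of every disagreeing participant from below. *)
case: (@arg_minP _ _ _ p P F Hp) => q Pq qmin.
have Dmin r : P r -> F q <= mdist pm pw mu1 r /\ F q <= mdist pm pw mu2 r.
  by move=> /qmin; rewrite [X in _ <= X]/F le_min => /andP.
have main D m1 m2 s : stable R pm pw tm tw m1 -> stable R pm pw tm tw m2 ->
    (forall r, mdist pm pw m1 r != mdist pm pw m2 r ->
     D <= mdist pm pw m1 r /\ D <= mdist pm pw m2 r) ->
    mdist pm pw m1 s = D -> mdist pm pw m2 s = D.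
  case: s => x s1 s2 H; first exact: match_dist_eq_minimal s1 s2 H.
  rewrite -(match_dist_dual _ _ m1) -(match_dist_dual _ _ m2).
  apply: (match_dist_eq_minimal (stable_dual s1) (stable_dual s2)).
  by move=> r; rewrite -[r]swapK !match_dist_dual; exact: H.
have Dmin' r : mdist pm pw mu2 r != mdist pm pw mu1 r ->
     F q <= mdist pm pw mu2 r /\ F q <= mdist pm pw mu1 r.
  by rewrite eq_sym => /Dmin [].
have [e|e] : F q = mdist pm pw mu1 q \/ F q = mdist pm pw mu2 q.
- by rewrite /F minEle; case: ifP; [left|right].
- by move: Pq; rewrite /P -e (main (F q) mu1 mu2) ?eqxx.
- by move: Pq; rewrite /P -e (main (F q) mu2 mu1) ?eqxx.
Qed.

Lemma stable_partner_profile pm pw tm tw mu1 mu2 m :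
  stable R pm pw tm tw mu1 -> stable R pm pw tm tw mu2 ->
  pw (mu1 m) = pw (mu2 m).
Proof. by move=> s1 s2; apply: dw_inj (match_dist_unique (inl m) s1 s2). Qed.

Section Existence.
Variables (pm pw : profiles n k).

Let d m w : R := dw R (pm m) (pw w).
(** The exponent counts the strictly more distant pairs. Base 3 makes one pair outweigh two more
    distant ones together. *)
Let g m w := (3 ^ #|[pred q : 'I_n * 'I_n | (d m w < d q.1 q.2)%R]|)%N.

Lemma greedy_weight m w m' w' : d m w < d m' w' -> (3 * g m' w' <= g m w)%N.
Proof.
move=> lt; rewrite /g -expnS leq_exp2l //.
apply: proper_card; apply/properP; split.
  by apply/fintype.subsetP => q; rewrite !inE; exact: lt_trans.
by exists (m', w'); rewrite !inE ?lt //= ltxx.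
Qed.

(* A maximiser of the potential matches lexicographically as many close pairs
   as possible. *)
Lemma greedy_matching : exists mu : {perm 'I_n}, forall m w,
  ~~ ((d m w < d m (mu m)) && (d m w < d ((mu^-1)%g w) w)).
Proof.
pose Phi mu := (\sum_m g m (mu m))%N.
case: (@arg_maxnP _ 1%g predT Phi isT) => mu _ mumax.
exists mu => m w; apply/negP => /andP[lt1 lt2].
(* [mu'] rematches [m] with [w] and [m'] with [mu m]. Only two terms of [Phi] change, and the two
   lost ones together are at most two thirds of the new term [g m w]. *)
pose m' := (mu^-1)%g w; pose mu' := (tperm m m' * mu)%g.
have mm' : m' != m by apply: contraTneq lt1 => <-; rewrite /m' permKV ltxx.
have := mumax mu' isT; rewrite /Phi /=.
rewrite (bigD1 m) //= (bigD1 m') //= [X in (_ <= X)%N](bigD1 m) //=.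
rewrite [X in (_ <= _ + X)%N](bigD1 m') //=.
rewrite !permM tpermL tpermR permKV.
rewrite (eq_bigr (fun i => g i (mu i))); last first.
  by move=> i /andP[im im']; rewrite permM tpermD // eq_sym.
have := greedy_weight lt1; have := greedy_weight lt2.
have : (0 < g m w)%N by rewrite expn_gt0.
rewrite -/m'; set S := (\sum_(_ < _ | _) _)%N.
move: (g _ _) (g _ _) (g _ _) (g _ _) => a b c e; lia.
Qed.

End Existence.

(** Existence comes from [greedy_matching]; any other stable matching gives [m] a partner with the
    same profile, hence the same partner. *)
Lemma stable_unique_injective pm pw tm tw : injective pm -> injective pw ->
  unique_without_ties R (pm, pw, (tm, tw)).
Proof.
move=> ipm ipw; have [mu Hmu] := greedy_matching pm pw.
have st tm' tw' : stable R pm pw tm' tw' mu.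
  (* Equal distances only occur for [y = z], so the tie-breaking lists never decide. *)
  have E (p q : profiles n k) (t : ties n) x y z : injective q ->
      man_prefers R p q t x y z = (dw R (p x) (q y) < dw R (p x) (q z)).
    move=> iq; rewrite /man_prefers /lexpref; case: eqP => [/dw_inj/iq ->|].
      by rewrite ltnn andbF orbF.
    by rewrite orbF.
  apply/stableP => m w; rewrite !E // => lt; apply: contraTN isT => lt2.
  by have := Hmu m w; rewrite lt dwC [X in _ < X]dwC lt2.
apply/existsP; exists mu; apply/forallP => tm'; apply/forallP => tw'.
apply/forallP => mu'; apply/eqP; apply/idP/eqP; last by move=> ->.
move=> st'; apply/permP => m; apply: ipw.
exact: stable_partner_profile st' (st tm' tw').
Qed.

End Matching.

(** * Expectations over finite uniform spaces *)

Section Mean.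
Variable R : realType.
Implicit Types T U A : finType.

Definition mean T (f : T -> R) : R := (\sum_t f t) / #|T|%:R.

Lemma mean_ge0 T (f : T -> R) : (forall t, 0 <= f t) -> 0 <= mean f.
Proof. by move=> f0; rewrite divr_ge0 ?sumr_ge0. Qed.

Lemma le_mean T (f g : T -> R) : (forall t, f t <= g t) -> mean f <= mean g.
Proof. by move=> fg; rewrite ler_wpM2r ?invr_ge0 // ler_sum. Qed.

Lemma eq_mean T (f g : T -> R) : f =1 g -> mean f = mean g.
Proof. by move=> fg; rewrite /mean (eq_bigr _ (fun t _ => fg t)). Qed.

Lemma mean_cst T (c : R) : (0 < #|T|)%N -> mean (fun _ : T => c) = c.
Proof.
move=> T0; rewrite /mean sumr_const -[c *+ _]mulr_natr mulfK //.
by rewrite pnatr_eq0 -lt0n.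
Qed.

Lemma meanD T (f g : T -> R) : mean (fun t => f t + g t) = mean f + mean g.
Proof. by rewrite /mean big_split mulrDl. Qed.

Lemma meanZl T (c : R) (f : T -> R) : mean (fun t => c * f t) = c * mean f.
Proof. by rewrite /mean -mulr_sumr mulrA. Qed.

Lemma mean_sum T (I : finType) (P : pred I) (f : I -> T -> R) :
  mean (fun t => \sum_(i | P i) f i t) = \sum_(i | P i) mean (f i).
Proof. by rewrite /mean exchange_big mulr_suml. Qed.

Lemma mean_pair T U (f : T * U -> R) :
  mean f = mean (fun t => mean (fun u => f (t, u))).
Proof.
rewrite /mean -mulr_suml pair_bigA card_prod natrM invfM mulrA /= mulrAC.
by congr (_ / _ / _); apply: eq_bigr => -[].
Qed.

Lemma mean_fst T U (f : T -> R) : (0 < #|U|)%N ->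
  mean (fun q : T * U => f q.1) = mean f.
Proof.
by move=> U0; rewrite mean_pair; apply: eq_mean => t /=; rewrite mean_cst.
Qed.

(* The map (t, a) |-> (upd t a, get t) is an involution. *)
Lemma mean_resample T A (get : T -> A) (upd : T -> A -> T) (f : T -> R) :
  (0 < #|A|)%N -> (forall t a, get (upd t a) = a) ->
  (forall t a, upd (upd t a) (get t) = t) ->
  mean f = mean (fun t => mean (fun a => f (upd t a))).
Proof.
move=> A0 getK updK; rewrite -(mean_fst f A0).
rewrite -(mean_pair (fun q => f (upd q.1 q.2))) /mean; congr (_ / _).
pose h (q : T * A) := (upd q.1 q.2, get q.1).
have hK : involutive h by case=> t a; rewrite /h /= getK updK.
by rewrite (reindex h) //; apply: onW_bij; exists h.
Qed.

Lemma Pr_mean T (E : pred T) : Pr R E = mean (fun t => (E t)%:R).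
Proof.
rewrite /Pr /mean -sum1_card natr_sum big_mkcond /=; congr (_ / _).
by apply: eq_bigr => t _; rewrite unfold_in; case: (E t).
Qed.

Lemma Pr_le_mean T (E : pred T) (f : T -> R) :
  (forall t, (E t)%:R <= f t) -> Pr R E <= mean f.
Proof. by rewrite Pr_mean; exact: le_mean. Qed.

Lemma Pr_ge0 T (E : pred T) : 0 <= Pr R E.
Proof. by rewrite Pr_mean; apply: mean_ge0 => t; exact: ler0n. Qed.

Lemma PrC T (E : pred T) : (0 < #|T|)%N -> Pr R E = 1 - Pr R (predC E).
Proof.
move=> T0; rewrite /Pr -(cardC E) natrD.
have : ((#|E| + #|predC E|)%:R : R) != 0 by rewrite cardC pnatr_eq0 -lt0n.
by rewrite natrD => ?; field.
Qed.

End Mean.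

(** * Random profiles: collisions and imbalances of prefix blocks *)

Section Profiles.
Variables (R : realType) (n k : nat).

Local Notation participant := ('I_n + 'I_n)%type.
Local Notation outcome := (profiles n k * profiles n k)%type.

Definition profile (P : outcome) (p : participant) : {ffun 'I_k -> bool} :=
  match p with inl m => P.1 m | inr w => P.2 w end.

Definition ffupd (I A : finType) (f : {ffun I -> A}) (i : I) (a : A) :=
  [ffun x => if x == i then a else f x].

Definition set_profile (P : outcome) (p : participant) a : outcome :=
  match p with inl m => (ffupd P.1 m a, P.2) | inr w => (P.1, ffupd P.2 w a) end.

Lemma set_profileE P p a q :
  profile (set_profile P p a) q = if q == p then a else profile P q.
Proof. by case: p => p; case: q => q /=; rewrite ?ffunE. Qed.

Lemma set_profileK P p a : set_profile (set_profile P p a) p (profile P p) = P.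
Proof.
case: P => pm pw; case: p => p /=; congr pair;
by apply/ffunP => i; rewrite !ffunE; case: eqP => // ->.
Qed.

Lemma card_participant : #|{: participant}| = (2 * n)%N.
Proof. by rewrite card_sum card_ord mul2n addnn. Qed.

Lemma card_profile_gt0 : (0 < #|{ffun 'I_k -> bool}|)%N.
Proof. by rewrite card_ffun card_bool expn_gt0. Qed.

Lemma card_outcome_gt0 : (0 < #|{: outcome}|)%N.
Proof.
apply/card_gt0P; pose a : profiles n k := [ffun _ => [ffun _ => false]].
by exists (a, a).
Qed.

Lemma card_ties_gt0 : (0 < #|{: ties n * ties n}|)%N.
Proof.
by apply/card_gt0P; exists ([ffun _ => 1%g], [ffun _ => 1%g]).
Qed.

Section Prefix.
Variables (j : nat) (jk : (j <= k)%N).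
Implicit Types P : outcome.

Definition same_block P p q := bit_prefix jk (profile P p) == bit_prefix jk (profile P q).

Lemma mean_prefix a : mean (fun b => (bit_prefix jk a == bit_prefix jk b)%:R) = 2 ^- j :> R.
Proof.
rewrite -(Pr_mean R [pred b | bit_prefix jk a == bit_prefix jk b]) /Pr.
rewrite card_ffun card_bool card_ord -(card_prefix jk a) natrM natrX.
rewrite invfM mulrA mulfV ?mul1r // pnatr_eq0 -lt0n.
by apply/card_gt0P; exists a; rewrite !inE eqxx.
Qed.

(** Resampling the profile of [q] leaves that of [p] untouched, so the prefix of [q] is uniform
    given that of [p]. *)
Lemma mean_same_block p q : p != q ->
  mean (fun P => (same_block P p q)%:R) = 2 ^- j :> R.
Proof.
move=> pq.
rewrite (@mean_resample _ _ _ (profile^~ q) (fun P a => set_profile P q a)).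
- rewrite -[RHS](@mean_cst _ outcome) ?card_outcome_gt0 //; apply: eq_mean => P.
  rewrite -(mean_prefix (profile P p)); apply: eq_mean => a.
  by rewrite /same_block !set_profileE eqxx (negbTE pq).
- exact: card_profile_gt0.
- by move=> P a; rewrite set_profileE eqxx.
- by move=> P a; rewrite set_profileK.
Qed.

(** Ordered pairs over both sexes together: same-sex pairs control multiple partners, mixed pairs
    control small matching distances. *)
Definition collisions P : R := \sum_p \sum_(q | q != p) (same_block P p q)%:R.

Lemma collisions_ge0 P : 0 <= collisions P.
Proof. by do 2 (apply: sumr_ge0 => ? _). Qed.

Lemma mean_collisions : mean collisions <= (2 * n)%:R ^+ 2 * 2 ^- j.
Proof.
apply: (@le_trans _ _ (\sum_(p : participant) (2 * n)%:R * 2 ^- j)); last first.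
  by rewrite sumr_const card_participant -[leLHS]mulr_natl expr2 mulrA.
rewrite mean_sum; apply: ler_sum => p _; rewrite mean_sum.
rewrite (eq_bigr (fun=> 2 ^- j)); last first.
  by move=> q qp; rewrite mean_same_block // eq_sym.
rewrite sumr_const -[leLHS]mulr_natl ler_wpM2r ?invr_ge0 ?exprn_ge0 // ler_nat.
by rewrite -card_participant max_card.
Qed.

(* imbalance P v is the number of men minus the number of women whose profile starts with v. *)
Definition sign (p : participant) : R := if p is inl _ then 1 else -1.

Definition imbalance P v : R := \sum_p sign p * (bit_prefix jk (profile P p) == v)%:R.

Lemma sum_imbalance_sqr P :
  \sum_v imbalance P v ^+ 2 = \sum_p \sum_q sign p * sign q * (same_block P p q)%:R.
Proof.
under eq_bigr => v _ do rewrite expr2 /imbalance mulr_suml.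
rewrite exchange_big; apply: eq_bigr => p _ /=.
under eq_bigr => v _ do rewrite mulr_sumr.
rewrite exchange_big; apply: eq_bigr => q _ /=.
rewrite (bigD1 (bit_prefix jk (profile P p))) //= big1 ?addr0; last first.
  by move=> v; rewrite eq_sym => /negbTE ->; rewrite mulr0 mul0r.
by rewrite eqxx mulr1 mulrA eq_sym.
Qed.

(** As the signs sum to zero, the constant part [2 ^- j] of the pair probabilities cancels and only
    the diagonal terms remain. *)
Lemma mean_sum_imbalance_sqr :
  mean (fun P => \sum_v imbalance P v ^+ 2) <= (2 * n)%:R.
Proof.
rewrite (eq_mean sum_imbalance_sqr) mean_sum.
have E p q : mean (fun P => (same_block P p q)%:R) = 2 ^- j + (1 - 2 ^- j) * (p == q)%:R :> R.
  case: eqVneq => [->|/mean_same_block ->]; last by rewrite mulr0 addr0.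
  rewrite mulr1 addrC subrK -[RHS](@mean_cst _ outcome) ?card_outcome_gt0 //.
  by apply: eq_mean => P; rewrite /same_block eqxx.
have sum_sign : \sum_p sign p = 0.
  by rewrite big_sumType /= !sumr_const -mulr_natr -[X in _ + X]mulr_natr; ring.
have -> : \sum_p mean (fun P => \sum_q sign p * sign q * (same_block P p q)%:R) =
    \sum_(p : participant) (1 - 2 ^- j).
  apply: eq_bigr => p _; rewrite mean_sum.
  under eq_bigr => q _ do rewrite meanZl E mulrDr.
  rewrite big_split /= -mulr_suml -mulr_sumr sum_sign mulr0 mul0r add0r.
  rewrite (bigD1 p) //= big1 ?addr0; last first.
    by move=> q; rewrite eq_sym => /negbTE ->; rewrite !mulr0.
  by rewrite eqxx mulr1; case: p => _ /=; ring.
rewrite sumr_const card_participant -[leLHS]mulr_natl.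
by rewrite ler_piMr // gerBl invr_ge0 exprn_ge0.
Qed.

(** The inequality [2 |x| <= t + x^2 / t], summed over the [2 ^ j] blocks. The weight [t] stays free
    for later tuning, in place of a Cauchy-Schwarz square root. *)
Lemma sum_norm_imbalance P (t : R) : 0 < t ->
  \sum_v `|imbalance P v| <= (2 ^+ j * t + t^-1 * \sum_v imbalance P v ^+ 2) / 2.
Proof.
move=> t0.
have -> : 2 ^+ j * t = \sum_(v : {ffun 'I_j -> bool}) t.
  by rewrite sumr_const cardT -cardE card_ffun card_bool card_ord -natrX mulr_natl.
rewrite mulr_sumr -big_split mulr_suml /=; apply: ler_sum => v _.
set x := imbalance P v; rewrite -[x ^+ 2]real_normK ?num_real //.
have : 0 <= t^-1 * (t - `|x|) ^+ 2 by rewrite mulr_ge0 ?sqr_ge0 // invr_ge0 ltW.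
have -> : t^-1 * (t - `|x|) ^+ 2 = t - 2 * `|x| + t^-1 * `|x| ^+ 2.
  by field; rewrite gt_eqF.
lra.
Qed.

End Prefix.

End Profiles.

(** * Deterministic counting of exceptional participants *)

Section Counting.
Variables (R : realType) (n k : nat).
Implicit Types (pm pw : profiles n k) (tm tw : ties n) (mu : {perm 'I_n}).
Local Notation mdist := (match_dist R).

Lemma same_block_full (P : profiles n k * profiles n k) p q :
  same_block (leqnn k) P p q = (profile P p == profile P q).
Proof.
apply/bit_prefixP/eqP => [H|-> //]; apply/ffunP => i; apply: H.
exact: ltn_ord.
Qed.

Lemma collisions_ge1 j (jk : (j <= k)%N) (P : profiles n k * profiles n k) p q :
  p != q -> same_block jk P p q -> 1 <= collisions R jk P.
Proof.
move=> pq spq; rewrite /collisions (bigD1 p) //= (bigD1 q) 1?eq_sym //= spq.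
rewrite -addrA lerDl addr_ge0 //; first exact: sumr_ge0.
by do 2 (apply: sumr_ge0 => ? _).
Qed.

Lemma not_unique_collisions (o : Omega n k) :
  (~~ unique_without_ties R o)%:R <= collisions R (leqnn k) o.1.
Proof.
case: o => -[pm pw] [tm tw]; case: (boolP (unique_without_ties _ _)) => [_|nu].
  exact: collisions_ge0.
have [ipm|nipm] := boolP (injectiveb pm); last first.
  have /injectivePn[m [m' mm' e]] := nipm.
  apply: (@collisions_ge1 _ _ _ (inl m) (inl m')) => //.
  by rewrite same_block_full /= e.
have [ipw|nipw] := boolP (injectiveb pw); last first.
  have /injectivePn[w [w' ww' e]] := nipw.
  apply: (@collisions_ge1 _ _ _ (inr w) (inr w')) => //.
  by rewrite same_block_full /= e.
by case/negP: nu; apply: stable_unique_injective; exact/injectiveP.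
Qed.

Definition twins (p : profiles n k) : R :=
  \sum_x \sum_(y | y != x) (p x == p y)%:R.

Lemma twins_collisions pm pw :
  twins pm + twins pw <= collisions R (leqnn k) (pm, pw).
Proof.
rewrite /collisions big_sumType /=; apply: lerD; apply: ler_sum => x _;
  rewrite big_sumType /= ?lerDl ?lerDr.
- rewrite [X in _ <= X + _](eq_bigr (fun y => (pm x == pm y)%:R)); last first.
    by move=> y _; rewrite same_block_full.
  by rewrite lerDl sumr_ge0.
- rewrite [X in _ <= _ + X](eq_bigr (fun y => (pw x == pw y)%:R)); last first.
    by move=> y _; rewrite same_block_full.
  by rewrite lerDr sumr_ge0.
Qed.

(* A second stable partner of m is a twin of the partner of m in any fixed
   stable matching. *)
Lemma man_multiple_twins pm pw tm tw :
  #|[pred m | man_multiple R pm pw tm tw m]|%:R <= twins pw.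
Proof.
have [[mu0 st0]|nst] := pselect (exists mu, stable R pm pw tm tw mu); last first.
  rewrite eq_card0; first by do 2 (apply: sumr_ge0 => ? _).
  move=> m; rewrite !inE /man_multiple; apply/negbTE/negP.
  move=> /existsP[mu /existsP[_ /and3P[st _ _]]].
  by apply: nst; exists mu.
(* Reindexing by [mu0] charges [m] to the twins of the woman [mu0 m]. *)
rewrite -sum1_card natr_sum big_mkcond /twins [leRHS](reindex_inj (@perm_inj _ mu0)).
apply: ler_sum => m _; rewrite inE /man_multiple; case: ifP => [|_]; last exact: sumr_ge0.
move=> /existsP[mu1 /existsP[mu2 /and3P[st1 st2 ne]]].
have [mu st mune] : exists2 mu, stable R pm pw tm tw mu & mu m != mu0 m.
  have [e|?] := eqVneq (mu1 m) (mu0 m); last by exists mu1.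
  by exists mu2 => //; rewrite -e eq_sym.
rewrite (bigD1 (mu m)) //= (stable_partner_profile m st0 st) eqxx lerDl.
exact: sumr_ge0.
Qed.

(** Men are charged to twins among the women and, after exchanging the sexes, women to twins among
    the men. *)
Lemma frac_multiple_collisions (o : Omega n k) :
  frac_multiple R o <= collisions R (leqnn k) o.1 / (2 * n)%:R.
Proof.
case: o => -[pm pw] [tm tw] /=; rewrite ler_wpM2r ?invr_ge0 //.
apply: le_trans (twins_collisions pm pw); rewrite natrD addrC.
apply: lerD; last exact: man_multiple_twins.
apply: le_trans (man_multiple_twins pw pm tw tm); rewrite ler_nat.
apply: subset_leq_card; apply/fintype.subsetP => w; rewrite !inE /woman_multiple /man_multiple.
move=> /existsP[mu1 /existsP[mu2 /and3P[st1 st2 ne]]].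
apply/existsP; exists (mu1^-1)%g; apply/existsP; exists (mu2^-1)%g.
by rewrite !stable_dual.
Qed.

Lemma sum_close_le j (jk : (j <= k)%N) pm pw mu :
  \sum_p (mdist pm pw mu p < 2 ^- j)%R%:R <= collisions R jk (pm, pw).
Proof.
apply: ler_sum => p _.
pose partner (r : 'I_n + 'I_n) : 'I_n + 'I_n :=
  match r with inl m => inr (mu m) | inr w => inl ((mu^-1)%g w) end.
rewrite (bigD1 (partner p)) /=; last by case: p.
rewrite /same_block -(dw_prefix R) (_ : dw _ _ _ = mdist pm pw mu p).
  by rewrite lerDl sumr_ge0.
by case: p.
Qed.

(* Were a man and a woman of block v both matched outside v, they would
   prefer each other; so all the unmatched participants of v have one sex. *)
Lemma block_unmatched j (jk : (j <= k)%N) pm pw tm tw mu v :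
  stable R pm pw tm tw mu ->
  \sum_m ((bit_prefix jk (pm m) == v) && (bit_prefix jk (pw (mu m)) != v))%:R
    <= `|imbalance R jk (pm, pw) v|.
Proof.
move=> st.
pose a m := bit_prefix jk (pm m) == v; pose b m := bit_prefix jk (pw (mu m)) == v.
(* Couples inside [v] cancel, leaving the men of [v] matched outside minus the women of [v] matched
   outside. *)
have imbE : imbalance R jk (pm, pw) v =
    \sum_m (a m && ~~ b m)%:R - \sum_m (b m && ~~ a m)%:R.
  rewrite /imbalance big_sumType /= [X in _ + X](reindex_inj (@perm_inj _ mu)) /=.
  rewrite -big_split -sumrB; apply: eq_bigr => m _ /=.
  rewrite -/(a m) -/(b m); case: (a m); case: (b m) => /=; ring.
(* If some [m1] outside [v] is matched to a woman of [v], a man of [v] matched outside would form a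
   blocking pair with her; otherwise the subtracted sum vanishes. *)
have [m1 /andP[b1 a1]|none] := pickP (fun m => b m && ~~ a m); last first.
  rewrite imbE [X in _ - X]big1 ?subr0 ?ler_norm //.
  by move=> m _; rewrite none.
rewrite big1 // => m _; apply/eqP; rewrite pnatr_eq0 eqb0.
apply/negP => /andP[am bm].
have dlt : dw R (pm m) (pw (mu m1)) < 2 ^- j.
  by rewrite (dw_prefix _ jk) (eqP am) eq_sym.
have /stableP/(_ m (mu m1)) := st.
rewrite /man_prefers /lexpref permK.
rewrite (lt_le_trans dlt) /=; last first.
  by rewrite leNgt (dw_prefix _ jk) (eqP am) eq_sym.
move=> /(_ isT); rewrite [dw R (pw _) _]dwC (lt_le_trans dlt) //.
by rewrite leNgt (dw_prefix _ jk) (eqP b1) eq_sym.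
Qed.

(** Both members of a couple have the same distance, whence the factor 2; a couple is far exactly
    when the man is matched outside his block. *)
Lemma sum_far_le j (jk : (j <= k)%N) pm pw tm tw mu : stable R pm pw tm tw mu ->
  \sum_p (2 ^- j <= mdist pm pw mu p)%R%:R
    <= 2 * \sum_v `|imbalance R jk (pm, pw) v|.
Proof.
move=> st; rewrite big_sumType /= [X in _ + X](reindex_inj (@perm_inj _ mu)) /=.
rewrite [X in _ + X](eq_bigr (fun m => (2 ^- j <= mdist pm pw mu (inl m))%R%:R)); last first.
  by move=> m _; rewrite permK dwC.
rewrite mulr_natl mulr2n -[leLHS]mulr2n -[leRHS]mulr2n lerMn2r /=.
apply: le_trans (ler_sum _ (fun v _ => block_unmatched jk v st)).
rewrite exchange_big; apply: ler_sum => m _ /=.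
rewrite (bigD1 (bit_prefix jk (pm m))) //= eqxx /= eq_sym -(dw_prefix R) -leNgt.
by rewrite lerDl sumr_ge0.
Qed.

(** Distances agree in all stable matchings, so the existential over [mu] can be evaluated at one
    fixed [mu0]. *)
Lemma sum_deviating_le j1 (jk1 : (j1 <= k)%N) j2 (jk2 : (j2 <= k)%N) pm pw tm tw :
  \sum_p [exists mu, stable R pm pw tm tw mu &&
           ((mdist pm pw mu p < 2 ^- j1) || (2 ^- j2 <= mdist pm pw mu p))%R]%:R
    <= collisions R jk1 (pm, pw) + 2 * \sum_v `|imbalance R jk2 (pm, pw) v|.
Proof.
have [[mu0 st0]|nst] := pselect (exists mu, stable R pm pw tm tw mu); last first.
  rewrite big1 ?addr_ge0 ?collisions_ge0 ?mulr_ge0 ?sumr_ge0 // => p _.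
  case: existsP => // -[mu /andP[st _]]; case: nst; by exists mu.
apply: le_trans (lerD (sum_close_le jk1 pm pw mu0) (sum_far_le jk2 st0)).
rewrite -big_split; apply: ler_sum => p _ /=.
case: existsP => [[mu /andP[st]]|_]; last by rewrite addr_ge0.
rewrite (match_dist_unique p st st0).
by case/orP => ->; rewrite ?lerDl ?lerDr ler0n.
Qed.

End Counting.

(** * First-moment bounds on the probabilities *)

Section Bounds.
Variables (R : realType) (n k : nat).
Hypothesis n0 : (0 < n)%N.

Let card_n_gt0 : 0 < (2 * n)%:R :> R.
Proof. by rewrite ltr0n muln_gt0. Qed.

Let mean_Omega (f : profiles n k * profiles n k -> R) :
  mean (fun o : Omega n k => f o.1) = mean f.
Proof. exact/mean_fst/card_ties_gt0. Qed.

Lemma Pr_not_unique :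
  Pr R (predC [pred o : Omega n k | unique_without_ties R o]) <=
  (2 * n)%:R ^+ 2 * 2 ^- k.
Proof.
apply: (le_trans _ (mean_collisions R n (leqnn k))).
rewrite -mean_Omega; apply: Pr_le_mean => o; exact: not_unique_collisions.
Qed.

Lemma Pr_frac_multiple (delta : R) : 0 < delta ->
  Pr R [pred o : Omega n k | delta < frac_multiple R o] <=
  delta^-1 * ((2 * n)%:R * 2 ^- k).
Proof.
move=> d0; apply: (@le_trans _ _ (mean (fun o : Omega n k =>
    (delta^-1 / (2 * n)%:R) * collisions R (leqnn k) o.1))).
  apply: Pr_le_mean => o /=; case: ltP => [lt|_] /=; last first.
    by rewrite mulr_ge0 ?collisions_ge0 // divr_ge0 // ltW // invr_gt0.
  rewrite -mulrA ler_pdivlMl // mulr1 mulrC; apply: le_trans (ltW lt) _.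
  exact: frac_multiple_collisions.
rewrite meanZl (mean_Omega (collisions R (leqnn k))) -mulrA ler_pM2l ?invr_gt0 //.
rewrite ler_pdivrMl // mulrA -expr2; exact: mean_collisions.
Qed.

(** Too small distances are handled by collisions of [j1]-bit prefixes, too large ones by imbalances
    of [j2]-bit blocks, with the weight [t] of [sum_norm_imbalance]. *)
Lemma Pr_X_deviates (delta : R) j1 j2 (t : R) : (j1 <= k)%N -> (j2 <= k)%N -> 0 < t ->
  (forall x : R, deviates n delta x -> (x < 2 ^- j1) || (2 ^- j2 <= x)) ->
  Pr R [pred op : (Omega n k * ('I_n + 'I_n))%type | X_deviates delta op] <=
  (2 * n)%:R * 2 ^- j1 + (2 ^+ j2 * t / (2 * n)%:R + t^-1).
Proof.
move=> jk1 jk2 t0 dev; rewrite Pr_mean mean_pair.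
pose f (P : profiles n k * profiles n k) := (2 * n)%:R^-1 * (collisions R jk1 P +
  (2 ^+ j2 * t + t^-1 * \sum_v imbalance R jk2 P v ^+ 2)).
apply: (@le_trans _ _ (mean (fun o : Omega n k => f o.1))).
  apply: le_mean => -[[pm pw] [tm tw]].
  rewrite /mean card_participant mulrC /f ler_pM2l ?invr_gt0 //=.
  have := sum_norm_imbalance jk2 (pm, pw) t0; rewrite ler_pdivlMr // [leLHS]mulrC => imb.
  apply: (le_trans _ (lerD (lexx _) imb)).
  apply: (le_trans _ (sum_deviating_le R jk1 jk2 pm pw tm tw)).
  apply: ler_sum => p _; rewrite ler_nat /X_deviates.
  have [/existsP[mu /andP[st dv]]|//] := boolP [exists mu,
    stable R pm pw tm tw mu && deviates n delta (match_dist R pm pw mu p)].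
  by case: existsP => // -[]; exists mu; rewrite st dev.
rewrite mean_Omega /f meanZl !meanD meanZl mean_cst ?card_outcome_gt0 //.
rewrite mulrDr; apply: lerD.
  rewrite ler_pdivrMl // mulrA -expr2; exact: mean_collisions.
rewrite meanZl mulrDr [X in X + _]mulrC lerD2l mulrCA ler_piMr ?invr_ge0 ?(ltW t0) //.
by rewrite ler_pdivrMl // mulr1; exact: mean_sum_imbalance_sqr.
Qed.

End Bounds.

(** * Comparison with powers of [n], and limits *)

Section Asymptotics.
Variable R : realType.
Implicit Types (n : nat) (a x : R).

Lemma cvg_powRN a : 0 < a -> (n%:R `^ (- a) : R) @[n --> \oo] --> (0 : R).
Proof.
move=> a0; apply/cvgr0Pnorm_lt => e e0; near=> n.
have n0 : (0 : R) < n%:R by rewrite ltr0n; near: n; exact: nbhs_infty_gt.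
rewrite ger0_norm ?powR_ge0 // powRN invf_plt ?posrE ?powR_gt0 //.
have -> : e^-1 = (e^-1 `^ a^-1) `^ a.
  by rewrite -powRrM mulVf ?gt_eqF // powRr1 // invr_ge0 ltW.
apply: gt0_ltr_powR; rewrite ?nnegrE ?powR_ge0 ?ler0n //.
by near: n; exact: nbhs_infty_gtr.
Unshelve. all: by end_near. Qed.

Lemma pow2_gt_powR n k x : (0 < n)%N -> x * log2 n%:R < k%:R ->
  n%:R `^ x < 2 ^+ k :> R.
Proof.
move=> n0; have ln2 : 0 < ln 2 :> R by rewrite ln_gt0 // ltr1n.
rewrite /log2 mulrA ltr_pdivrMr // => lt.
have npos : (0 : R) < n%:R by rewrite ltr0n.
rewrite -powR_mulrn // -ltr_ln ?posrE ?powR_gt0 //.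
by rewrite !ln_powR.
Qed.

Lemma dyadic_bracket x : 1 <= x -> exists j : nat, 2 ^+ j <= x < 2 ^+ j.+1.
Proof.
move=> x1; have Pex : exists j : nat, x < 2 ^+ j.
  by exists (Num.bound x); exact: upper_nthrootP.
case: (ex_minnP Pex) => -[|j] Pj jmin.
  by move: Pj; rewrite expr0 ltNge x1.
exists j; rewrite Pj andbT leNgt; apply/negP => /jmin.
by rewrite ltnn.
Qed.

Lemma deviates_powR n delta x : (1 < n)%N -> deviates n delta x ->
  (x < n%:R `^ (- (1 + delta))) || (n%:R `^ (- (1 - delta)) < x).
Proof.
move=> n1.
have lnn : 0 < ln n%:R :> R by rewrite ln_gt0 // ltr1n.
have npos : (0 : R) < n%:R by rewrite ltr0n ltnW.
(* The value 0, whose logarithm counts as minus infinity, falls under the first alternative. *)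
have [x0 _|x0] := leP x 0; first by rewrite (le_lt_trans x0) ?powR_gt0.
rewrite /deviates gt_eqF //=.
have -> : log2 x / log2 n%:R = ln x / ln n%:R.
  have ln2 : 0 < ln 2 :> R by rewrite ln_gt0 // ltr1n.
  by rewrite /log2; field; rewrite !gt_eqF.
have -> y : (x < n%:R `^ y) = (ln x / ln n%:R < y).
  by rewrite -[LHS]ltr_ln ?posrE ?powR_gt0 // ln_powR ltr_pdivrMr.
have -> y : (n%:R `^ y < x) = (y < ln x / ln n%:R).
  by rewrite -[LHS]ltr_ln ?posrE ?powR_gt0 // ln_powR ltr_pdivlMr.
by rewrite ltr_normr => /orP[?|?]; apply/orP; [right|left]; lra.
Qed.

(** The slack [e] absorbs the summand [t^-1] of [Pr_X_deviates]; [c] and [a] may depend on it. *)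
Lemma cvg0_powRN_bound (u : nat -> R) : (forall n, 0 <= u n) ->
  (forall e, 0 < e -> exists c a, 0 < a /\
     forall n, (1 < n)%N -> u n <= c * n%:R `^ (- a) + e) ->
  u @ \oo --> (0 : R).
Proof.
move=> u0 H; apply/cvgr0Pnorm_lt => e e0.
have [c [a [a0 {}H]]] := H (e / 2) (divr_gt0 e0 (ltr0Sn _ _)).
have c0 : 0 < `|c| + 1 by rewrite ltr_wpDl.
have e2 : 0 < e / 2 / (`|c| + 1) by rewrite !divr_gt0.
near=> n.
have n1 : (1 < n)%N by near: n; exact: nbhs_infty_gt.
rewrite ger0_norm //; apply: (le_lt_trans (H n n1)).
rewrite [ltRHS](splitr e) ltrD2r.
have : n%:R `^ (- a) < e / 2 / (`|c| + 1).
  by rewrite -[ltLHS]ger0_norm ?powR_ge0 //; near: n;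
     apply: cvgr0_norm_lt e2; exact: cvg_powRN.
rewrite ltr_pdivlMr // mulrC; apply: le_lt_trans.
by rewrite ler_wpM2r ?powR_ge0 // (le_trans (ler_norm c)) // lerDl.
Unshelve. all: by end_near. Qed.

End Asymptotics.

(** * Choice of the parameters and passage to the limit *)

Theorem theorem3p4 (R : realType) (eps : R) (heps : 0 < eps) :
  (forall k : nat -> nat,
     (forall n : nat, (1 + eps) * log2 (n%:R : R) < (k n)%:R) ->
     (forall delta : R, 0 < delta ->
        (fun n => Pr R [pred o : Omega n (k n) | delta < frac_multiple R o])
          @ \oo --> (0 : R)) /\
     (forall delta : R, 0 < delta ->
        (fun n => Pr R [pred op : (Omega n (k n) * ('I_n + 'I_n))%type |
                        X_deviates delta op])
          @ \oo --> (0 : R))) /\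
  (forall k : nat -> nat,
     (forall n : nat, (2 + eps) * log2 (n%:R : R) < (k n)%:R) ->
     (fun n => Pr R [pred o : Omega n (k n) | unique_without_ties R o])
       @ \oo --> (1 : R)).
Proof.
have natpow n x y : (0 < n)%N -> n%:R `^ (x + y) = n%:R `^ x * n%:R `^ y :> R.
  by move=> n0; rewrite powRD // pnatr_eq0 -lt0n n0 implybT.
have natpos n : (0 < n)%N -> (0 : R) < n%:R by rewrite ltr0n.
have pow2V n k x : (0 < n)%N -> x * log2 n%:R < k%:R -> 2 ^- k <= n%:R `^ (- x) :> R.
  move=> n0 /(pow2_gt_powR n0)/ltW le.
  by rewrite powRN lef_pV2 ?posrE ?powR_gt0 ?exprn_gt0 ?natpos.
split=> k Hk.
  split=> delta d0; apply: cvg0_powRN_bound => [n|e e0]; try exact: Pr_ge0.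
    (* The bound [delta^-1 * 2n * 2 ^- k] is combined with [2 ^- k <= n ^ -(1 + eps)]. *)
    exists (delta^-1 * 2), eps; split=> // n n1; have n0 := ltnW n1.
    apply: ler_wpDr; first exact: ltW.
    apply: (le_trans (Pr_frac_multiple _ n0 d0)).
    rewrite -mulrA ler_pM2l ?invr_gt0 //.
    apply: (le_trans (ler_wpM2l _ (pow2V _ _ _ n0 (Hk n)))); first exact: ler0n.
    rewrite opprD natpow // powR_inv1 ?ler0n // natrM -mulrA ler_pM2l //.
    by rewrite mulrA mulfV ?mul1r // gt_eqF ?natpos.
  (* [a <= delta] narrows the window around -1, [a <= eps] keeps the prefix lengths within [k n],
     and [a <= 1] makes [n ^ (1 - a)] at least 1. *)
  pose a := Num.min delta (Num.min eps 1).
  have [ad aeps a1] : [/\ a <= delta, a <= eps & a <= 1].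
    by split; rewrite /a !ge_min lexx ?orbT.
  have a0 : 0 < a by rewrite /a !lt_min d0 heps ltr01.
  (* With [t = e^-1]: the collision term is at most [2n * 2 n ^ -(1 + a) = 4 n ^ -a], the block term
     at most [e^-1 * n ^ -a], and [t^-1 = e] is the slack. *)
  exists (4 + e^-1), a; split=> // n n1; have n0 := ltnW n1.
  have n1R : (1 : R) <= n%:R by rewrite ler1n.
  have kn := pow2_gt_powR n0 (Hk n).
  have big x : 0 <= x -> (1 : R) <= n%:R `^ x.
    by move=> x0; rewrite -[leLHS](powRr0 (n%:R : R)) ler_powR.
  (* The lengths used are [j1], rounded down, and [j2.+1], rounded up, so that the dyadic window
     contains the window given by [a]. *)
  have [|j1 /andP[j1le j1gt]] := @dyadic_bracket R (n%:R `^ (1 + a)).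
    by apply: big; lra.
  have [|j2 /andP[j2le j2gt]] := @dyadic_bracket R (n%:R `^ (1 - a)).
    by apply: big; lra.
  have ltk j x : 2 ^+ j <= n%:R `^ x :> R -> x <= 1 + eps -> (j < k n)%N.
    move=> jx xe; rewrite -(ltr_eXn2l (x := 2 : R)) ?ltr1n //.
    by apply: (le_lt_trans jx); apply: le_lt_trans kn; exact: ler_powR.
  have jk1 : (j1 <= k n)%N by apply/ltnW/(ltk _ _ j1le); lra.
  have jk2 : (j2.+1 <= k n)%N by apply: (ltk _ _ j2le); lra.
  have t0 : 0 < e^-1 by rewrite invr_gt0.
  have powV j x : 2 ^+ j <= n%:R `^ x :> R -> n%:R `^ (- x) <= 2 ^- j :> R.
    by move=> le; rewrite powRN lef_pV2 ?posrE ?powR_gt0 ?exprn_gt0 ?natpos.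
  have powV' j x : n%:R `^ x < 2 ^+ j :> R -> 2 ^- j <= n%:R `^ (- x) :> R.
    by move=> /ltW le; rewrite powRN lef_pV2 ?posrE ?powR_gt0 ?exprn_gt0 ?natpos.
  apply: (le_trans (Pr_X_deviates n0 jk1 jk2 t0 _)) => [x|].
    case/(deviates_powR n1)/orP => ltx; apply/orP; [left|right].
      apply: (lt_le_trans ltx); apply: le_trans (powV _ _ j1le).
      by apply: ler_powR => //; lra.
    apply/ltW/(le_lt_trans _ ltx); apply: le_trans (powV' _ _ j2gt) _.
    by apply: ler_powR => //; lra.
  rewrite invrK addrA lerD2r mulrDl; apply: lerD.
    have : 2 ^- j1 <= 2 * n%:R `^ (- (1 + a)) :> R.
      have := powV' _ _ j1gt; rewrite exprS invfM => h.
      by rewrite -ler_pdivrMl.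
    rewrite opprD natpow // powR_inv1 ?ler0n // => h.
    apply: (le_trans (ler_wpM2l (ler0n _ _) h)).
    rewrite natrM le_eqVlt; apply/orP; left; apply/eqP.
    by field; rewrite gt_eqF ?natpos.
  rewrite mulrAC mulrC ler_pM2l // ler_pdivrMr ?ltr0n ?muln_gt0 //.
  move: j2le; rewrite natpow // powRr1 // => h.
  rewrite exprS natrM mulrCA ler_pM2l //.
  by apply: le_trans h _; rewrite mulrC.
have uE n : 1 - Pr R (predC [pred o : Omega n (k n) | unique_without_ties R o]) =
    Pr R [pred o : Omega n (k n) | unique_without_ties R o].
  by rewrite -PrC // card_prod muln_gt0 card_outcome_gt0 card_ties_gt0.
have lim0 : (fun n => Pr R (predC [pred o : Omega n (k n) | unique_without_ties R o]))
    @ \oo --> (0 : R); last first.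
  rewrite -(eq_cvg _ _ uE); have lim1 : (fun n => 1 - Pr R (predC [pred o : Omega n (k n) |
      unique_without_ties R o])) @ \oo --> (1 - 0 : R).
    by apply: cvgB lim0; exact: cvg_cst.
  by move: lim1; rewrite subr0.
apply: cvg0_powRN_bound => [n|e e0]; first exact: Pr_ge0.
(* Here [(2n)^2 * n ^ -(2 + eps) = 4 n ^ -eps]. *)
exists 4, eps; split=> // n n1; have n0 := ltnW n1.
apply: ler_wpDr; first exact: ltW.
apply: (le_trans (Pr_not_unique _ _ _)).
apply: (le_trans (ler_wpM2l _ (pow2V _ _ _ n0 (Hk n)))); first exact: sqr_ge0.
rewrite opprD natpow // powR_invn ?ler0n // natrM le_eqVlt; apply/orP; left; apply/eqP.
by field; rewrite gt_eqF ?natpos.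
Qed.
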